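(* For every triple of real positive parameters $(\mu,\lambda_1,\lambda_2)$ there exists an energy $\bar E=\bar E(\mu,\lambda_1,\lambda_2)>0$ such that, for every $x_0\in\mathbb{R}\setminus\{0\}$, the solution $(\bar y,0,0)=(x_0\cos(\mu t),0,0)$ of system (S) with $\varepsilon=0$ is stable provided that its conserved energy $E=\frac{\mu^2}{2}x_0^2$ satisfies $E\le\bar E$.
   Context: For $\mu,\lambda_1,\lambda_2>0$, $x_0\in\mathbb{R}\setminus\{0\}$ and $\varepsilon\ge 0$, system (S) is the Hamiltonian system $$\begin{cases}\ddot y+\mu^2y+(z_1^2+z_2^2)y=0, & y(0)=x_0,\ \dot y(0)=0,\\ \ddot z_1+\lambda_1^2z_1+(y^2+z_2^2)z_1=0, & z_1(0)=\varepsilon x_0,\ \dot z_1(0)=0,\\ \ddot z_2+\lambda_2^2z_2+(y^2+z_1^2)z_2=0, & z_2(0)=\varepsilon x_0,\ \dot z_2(0)=0.\end{cases}$$ For $\varepsilon=0$ its unique solution is $(\bar y,0,0)=(x_0\cos(\mu t),0,0)$, with conserved energy $E=\frac{\dot y^2}{2}+\frac{\mu^2}{2}y^2=\frac{\mu^2}{2}x_0^2$. Linearizing the $z_i$ equations around $(\bar y,0,0)$ gives $\ddot\xi_i+\big(\lambda_i^2+\frac{x_0^2}{2}+\frac{x_0^2}{2}\cos(2\mu t)\big)\xi_i=0$, which after rescaling time becomes the Mathieu equation in canonical form $$\ddot\xi_i+\big(\alpha_i+2q\cos(2t)\big)\xi_i=0,\qquad \alpha_i=\frac{2\lambda_i^2+x_0^2}{2\mu^2},\qquad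 q=\frac{x_0^2}{4\mu^2},\qquad i=1,2. \tag{M$_i$}$$ Definition. The solution $(\bar y,0,0)=(x_0\cos(\mu t),0,0)$ of system (S) for $\varepsilon=0$ is said to be stable if the trivial solutions $\xi_i\equiv 0$ of (M$_i$), $i=1,2$, are both stable (in the sense of Lyapunov); otherwise it is said to be unstable. *)

(* Defs.v *)
From Stdlib Require Import Reals Lra.
From Coquelicot Require Import Coquelicot.
Open Scope R_scope.

Definition solves_S (mu lambda1 lambda2 x0 eps : R) (y z1 z2 : R -> R) : Prop :=
  (forall t, ex_derive y t /\ ex_derive z1 t /\ ex_derive z2 t) /\
  (forall t,
     is_derive (Derive y) t (- (mu ^ 2 * y t + (z1 t ^ 2 + z2 t ^ 2) * y t)) /\
     is_derive (Derive z1) t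
       (- (lambda1 ^ 2 * z1 t + (y t ^ 2 + z2 t ^ 2) * z1 t)) /\
     is_derive (Derive z2) t
       (- (lambda2 ^ 2 * z2 t + (y t ^ 2 + z1 t ^ 2) * z2 t))) /\
  (y 0 = x0 /\ Derive y 0 = 0) /\
  (z1 0 = eps * x0 /\ Derive z1 0 = 0) /\
  (z2 0 = eps * x0 /\ Derive z2 0 = 0).

Definition ybar (mu x0 t : R) : R := x0 * cos (mu * t).

Definition energy (mu : R) (y : R -> R) (t : R) : R :=
  Derive y t ^ 2 / 2 + mu ^ 2 / 2 * y t ^ 2.

Lemma Derive_ybar (mu x0 t : R) :
  Derive (ybar mu x0) t = - (x0 * mu * sin (mu * t)).
Proof.
apply is_derive_unique; unfold ybar; auto_derive; [exact I | ring].
Qed.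

Lemma ybar_solves_S (mu lambda1 lambda2 x0 : R) :
  solves_S mu lambda1 lambda2 x0 0 (ybar mu x0) (fun _ => 0) (fun _ => 0).
Proof.
assert (H0 : forall t, Derive (fun _ : R => 0) t = 0)
  by (intros t; apply Derive_const).
assert (H00 : forall t, is_derive (Derive (fun _ : R => 0)) t 0).
{ intros t; apply is_derive_ext with (fun _ : R => 0).
  - intros s; symmetry; apply H0.
  - auto_derive; [exact I | ring]. }
split; [|split; [|split; [|split]]].
- intros t; split; [|split]; [unfold ybar | |]; auto_derive; exact I.
- intros t; split; [|split].
  + apply is_derive_ext with (fun s => - (x0 * mu * sin (mu * s))).
    * intros s; symmetry; apply Derive_ybar.
    * unfold ybar; auto_derive; [exact I | ring].
  + replace (- _) with 0 by ring; apply H00.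
  + replace (- _) with 0 by ring; apply H00.
- split.
  + unfold ybar; rewrite Rmult_0_r, cos_0; ring.
  + rewrite Derive_ybar, Rmult_0_r, sin_0; ring.
- split; [ring | apply H0].
- split; [ring | apply H0].
Qed.

Lemma energy_ybar (mu x0 t : R) :
  energy mu (ybar mu x0) t = mu ^ 2 / 2 * x0 ^ 2.
Proof.
unfold energy; rewrite Derive_ybar; unfold ybar.
assert (H := sin2_cos2 (mu * t)); unfold Rsqr in H.
replace (mu ^ 2 / 2 * x0 ^ 2) with (mu ^ 2 / 2 * x0 ^ 2 * 1) by ring.
rewrite <- H; field.
Qed.

Definition solves_mathieu (alpha q : R) (xi : R -> R) : Prop :=
  forall t, ex_derive xi t /\
    is_derive (Derive xi) t (- ((alpha + 2 * q * cos (2 * t)) * xi t)).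

(* Lyapunov stability in the phase plane (xi, xi'), for the sup norm and for
   every initial time.  Solutions are taken on all of R: the equation is
   linear with continuous coefficients, so every solution extends to R. *)
Definition mathieu_trivial_stable (alpha q : R) : Prop :=
  forall t0 eps : R, 0 < eps ->
  exists delta : R, 0 < delta /\
    forall xi : R -> R, solves_mathieu alpha q xi ->
      Rabs (xi t0) < delta -> Rabs (Derive xi t0) < delta ->
      forall t, t0 <= t -> Rabs (xi t) < eps /\ Rabs (Derive xi t) < eps.

(* Linearizing the z_i equations of [solves_S] around (ybar, 0, 0) gives
   xi'' + (lambda_i^2 + x0^2/2 + x0^2/2 cos(2 mu t)) xi = 0; replacing mu t by
   t turns it into the Mathieu equation with these two coefficients. *)
Definition mathieu_alpha (mu lambda x0 : R) : R :=
  (2 * lambda ^ 2 + x0 ^ 2) / (2 * mu ^ 2).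

Definition mathieu_q (mu x0 : R) : R := x0 ^ 2 / (4 * mu ^ 2).

(* Stability of the solution (ybar, 0, 0) of the system with eps = 0. *)
Definition ybar_stable (mu lambda1 lambda2 x0 : R) : Prop :=
  mathieu_trivial_stable (mathieu_alpha mu lambda1 x0) (mathieu_q mu x0) /\
  mathieu_trivial_stable (mathieu_alpha mu lambda2 x0) (mathieu_q mu x0).

(* Main.v *)
Require Import Defs.
From Stdlib Require Import Reals Lra Classical.
From Coquelicot Require Import Coquelicot.
Open Scope R_scope.

(* With w = lambda / mu and s = x0^2 / mu^2 the Mathieu equation reads
   xi'' + (w^2 + s cos^2 t) xi = 0, an even PI-periodic positive perturbation
   of the harmonic oscillator.  Let c, d be the even and odd normalized
   solutions.  Evenness gives the period map [[c, d], [c', c]](PI), so all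
   solutions are bounded as soon as c'(PI) d(PI) < 0.  For s = 0 this product
   is - sin^2 (w PI), and the inequality persists for small s when w is not an
   integer.  When w is an integer both factors vanish at s = 0, but the
   perturbation is nonnegative, so to first order in s it moves them in
   opposite directions. *)

(** * Mean value inequalities *)

Lemma increment_le (f df : R -> R) (a b M : R) : a <= b ->
  (forall t, is_derive f t (df t)) -> (forall t, a <= t <= b -> df t <= M) ->
  f b - f a <= M * (b - a).
Proof.
intros ab Hf Hdf.
destruct (MVT_gen f a b df) as [c [Hc ->]].
- intros; apply Hf.
- intros x _; apply continuity_pt_filterlim, (ex_derive_continuous f).
  exists (df x); apply Hf.
- rewrite Rmin_left, Rmax_right in Hc by lra.
  apply Rmult_le_compat_r; [lra | now apply Hdf].
Qed.

Lemma increment_abs_le (f df : R -> R) (a b M : R) : a <= b ->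
  (forall t, is_derive f t (df t)) ->
  (forall t, a <= t <= b -> Rabs (df t) <= M) ->
  Rabs (f b - f a) <= M * (b - a).
Proof.
intros ab Hf Hdf.
assert (H1 : f b - f a <= M * (b - a)).
{ apply (increment_le f df); trivial.
  intros t Ht; specialize (Hdf t Ht); apply Rabs_le_between in Hdf; lra. }
assert (H2 : (- f b) - (- f a) <= M * (b - a)).
{ apply (increment_le (fun t => - f t) (fun t => - df t)); trivial.
  - intros t; apply (is_derive_opp f), Hf.
  - intros t Ht; specialize (Hdf t Ht); apply Rabs_le_between in Hdf; lra. }
apply Rabs_le; lra.
Qed.

Lemma exp_le (x y : R) : x <= y -> exp x <= exp y.
Proof.
intros [H | ->]; [left; now apply exp_increasing | right; reflexivity].
Qed.

(** * The perturbed oscillator and its symmetries *)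

(** The derivative is carried as a separate function [v], so that combinations, reflections and
    translations act on pairs. *)
Definition hill (w s : R) (u v : R -> R) : Prop :=
  forall t, is_derive u t (v t) /\
    is_derive v t (- ((w ^ 2 + s * cos t ^ 2) * u t)).

(** Twice the energy of the unperturbed oscillator of frequency [w]. *)
Definition amp (w : R) (u v : R -> R) (t : R) : R := v t ^ 2 + w ^ 2 * u t ^ 2.

Lemma hill_lincomb (w s a b : R) (u1 v1 u2 v2 : R -> R) :
  hill w s u1 v1 -> hill w s u2 v2 ->
  hill w s (fun t => a * u1 t + b * u2 t) (fun t => a * v1 t + b * v2 t).
Proof.
intros H1 H2 t; destruct (H1 t) as [U1 V1], (H2 t) as [U2 V2]; split.
- apply (is_derive_plus (fun t => a * u1 t) (fun t => b * u2 t));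
    apply is_derive_scal; assumption.
- replace (- _) with (a * - ((w ^ 2 + s * cos t ^ 2) * u1 t) +
    b * - ((w ^ 2 + s * cos t ^ 2) * u2 t)) by ring.
  apply (is_derive_plus (fun t => a * v1 t) (fun t => b * v2 t));
    apply is_derive_scal; assumption.
Qed.

Lemma hill_reflect (w s : R) (u v : R -> R) :
  hill w s u v -> hill w s (fun t => u (- t)) (fun t => - v (- t)).
Proof.
intros H t; destruct (H (- t)) as [U V]; split.
- replace (- v (- t)) with (-1 * v (- t)) by ring.
  apply (is_derive_comp u (fun t => - t)); [assumption|].
  auto_derive; [exact I | ring].
- rewrite cos_neg in V.
  replace (- _) with
    (- (-1 * - ((w ^ 2 + s * cos t ^ 2) * u (- t)))) by ring.
  apply (is_derive_opp (fun t => v (- t))).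
  apply (is_derive_comp v (fun t => - t)); [assumption|].
  auto_derive; [exact I | ring].
Qed.

(** If [sin c = 0] then [cos c ^ 2 = 1], so the coefficient is invariant under translation by [c].
    This covers [PI], [- PI] and [INR k * PI] at once. *)
Lemma hill_shift (w s c : R) (u v : R -> R) : sin c = 0 ->
  hill w s u v -> hill w s (fun t => u (t + c)) (fun t => v (t + c)).
Proof.
intros Hc H t; destruct (H (t + c)) as [U V].
assert (D : is_derive (fun t => t + c) t 1) by (auto_derive; [exact I | ring]).
assert (Hcos : cos (t + c) ^ 2 = cos t ^ 2).
{ assert (E := sin2_cos2 c); unfold Rsqr in E.
  rewrite cos_plus, Hc in *.
  replace (_ ^ 2) with (cos t ^ 2 * (0 * 0 + cos c * cos c)) by ring.
  rewrite E; ring. }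
rewrite Hcos in V; split.
- replace (v (t + c)) with (1 * v (t + c)) by ring.
  now apply (is_derive_comp u (fun t => t + c)).
- replace (- _) with (1 * - ((w ^ 2 + s * cos t ^ 2) * u (t + c))) by ring.
  now apply (is_derive_comp v (fun t => t + c)).
Qed.

(** * Growth of the amplitude and uniqueness *)

Lemma cos_sq_bound (t : R) : 0 <= cos t ^ 2 <= 1.
Proof.
assert (H := COS_bound t); split; [apply pow2_ge_0 | nra].
Qed.

Lemma amp_ge_0 (w : R) (u v : R -> R) (t : R) : 0 <= amp w u v t.
Proof.
unfold amp.
assert (H1 := pow2_ge_0 (v t)); assert (H2 := pow2_ge_0 (w * u t)); nra.
Qed.

(** A Gronwall argument: the derivative of [amp] is [- 2 s cos^2 t u v], and [2 w |u v| <= amp], so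
    [amp] times [exp (- (k * t))] is nonincreasing. *)
Lemma amp_growth_right (w s : R) (u v : R -> R) (a b : R) :
  0 < w -> 0 <= s -> hill w s u v -> a <= b ->
  amp w u v b <= amp w u v a * exp (s / w * (b - a)).
Proof.
intros w0 s0 H ab.
set (k := s / w).
assert (D : amp w u v b * exp (- (k * b)) - amp w u v a * exp (- (k * a))
   <= 0 * (b - a)).
{ apply (increment_le (fun t => amp w u v t * exp (- (k * t)))
   (fun t => (- (2 * s * cos t ^ 2 * u t * v t) - k * amp w u v t)
      * exp (- (k * t)))); trivial.
  - intros t; destruct (H t) as [U V].
    unfold amp; auto_derive.
    + repeat split; eexists; eassumption.
    + rewrite (is_derive_unique (fun x : R => u x) t _ U),
        (is_derive_unique (fun x : R => v x) t _ V); ring.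
  - intros t _.
    assert (E := exp_pos (- (k * t))).
    assert (- (2 * s * cos t ^ 2 * u t * v t) <= k * amp w u v t); [|nra].
    replace (k * amp w u v t) with
      (s * ((v t - w * u t) ^ 2 / w + 2 * (u t * v t)))
      by (unfold k, amp; field; lra).
    assert (A1 : 0 <= (v t - w * u t) ^ 2 / w)
      by (apply Rdiv_le_0_compat; [apply pow2_ge_0 | lra]).
    assert (A2 : (v t - w * u t) ^ 2 / w + 2 * (u t * v t) =
      (v t + w * u t) ^ 2 / w - 2 * (u t * v t)) by (field; lra).
    assert (A3 : 0 <= (v t + w * u t) ^ 2 / w)
      by (apply Rdiv_le_0_compat; [apply pow2_ge_0 | lra]).
    assert (C := cos_sq_bound t).
    replace (- (2 * s * cos t ^ 2 * u t * v t)) with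
      (s * (- 2 * cos t ^ 2 * (u t * v t))) by ring.
    apply Rmult_le_compat_l; [lra|].
    nra. }
replace (k * (b - a)) with (k * b + - (k * a)) by ring.
rewrite exp_plus, (Rmult_comm (exp (k * b))), <- Rmult_assoc.
replace (amp w u v b) with (amp w u v b * exp (- (k * b)) * exp (k * b)).
- apply Rmult_le_compat_r; [left; apply exp_pos | lra].
- rewrite Rmult_assoc, <- exp_plus.
  replace (- (k * b) + k * b) with 0 by ring; rewrite exp_0; ring.
Qed.

(** Backward in time, the forward estimate is applied to the reflected solution. *)
Lemma amp_growth (w s : R) (u v : R -> R) (a b : R) :
  0 < w -> 0 <= s -> hill w s u v ->
  amp w u v b <= amp w u v a * exp (s / w * Rabs (b - a)).
Proof.
intros w0 s0 H.
destruct (Rle_dec a b) as [ab|ab].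
- rewrite Rabs_right by lra; now apply amp_growth_right.
- rewrite Rabs_left by lra.
  assert (G := amp_growth_right w s _ _ (- a) (- b) w0 s0
    (hill_reflect w s u v H)).
  unfold amp in *; rewrite !Ropp_involutive in G.
  replace (- (b - a)) with (- b - - a) by ring.
  replace ((v b) ^ 2) with ((- v b) ^ 2) by ring.
  replace ((v a) ^ 2) with ((- v a) ^ 2) by ring.
  apply G; lra.
Qed.

Lemma hill_null (w s : R) (u v : R -> R) :
  0 < w -> 0 <= s -> hill w s u v -> u 0 = 0 -> v 0 = 0 ->
  forall t, u t = 0 /\ v t = 0.
Proof.
intros w0 s0 H Hu Hv t.
assert (G := amp_growth w s u v 0 t w0 s0 H); unfold amp in G.
rewrite Hu, Hv in G.
assert (H1 := pow2_ge_0 (v t)); assert (H2 := pow2_ge_0 (w * u t)).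
assert (E1 : v t * v t = 0) by nra.
assert (E2 : (w * u t) * (w * u t) = 0) by nra.
apply Rsqr_0_uniq in E1; apply Rsqr_0_uniq in E2.
split; [|assumption].
apply Rmult_integral in E2; destruct E2; lra.
Qed.

Lemma hill_unique (w s : R) (u1 v1 u2 v2 : R -> R) :
  0 < w -> 0 <= s -> hill w s u1 v1 -> hill w s u2 v2 ->
  u1 0 = u2 0 -> v1 0 = v2 0 -> forall t, u1 t = u2 t /\ v1 t = v2 t.
Proof.
intros w0 s0 H1 H2 Hu Hv t.
assert (H := hill_null w s _ _ w0 s0
  (hill_lincomb w s 1 (-1) _ _ _ _ H1 H2)).
destruct (H ltac:(cbv beta; lra) ltac:(cbv beta; lra) t); lra.
Qed.

(** * Comparison with the free oscillator on one period *)

(* [w] times the solution of u'' + w^2 u = 0 with data [(x, y)] at 0. *)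
Definition free (w x y t : R) : R := y * sin (w * t) + w * x * cos (w * t).

Lemma free_bound (w x y t : R) : Rabs (free w x y t) <= Rabs y + Rabs (w * x).
Proof.
unfold free.
eapply Rle_trans; [apply Rabs_triang|].
rewrite !Rabs_mult.
assert (S : Rabs (sin (w * t)) <= 1) by (apply Rabs_le, SIN_bound).
assert (C : Rabs (cos (w * t)) <= 1) by (apply Rabs_le, COS_bound).
assert (H1 := Rabs_pos y).
assert (H2 : 0 <= Rabs w * Rabs x)
  by (apply Rmult_le_pos; apply Rabs_pos).
nra.
Qed.

(** [B] is chosen before [s], so that later thresholds on [s] depend only on [w] and the initial
    data. *)
Lemma hill_bounded (w : R) (x y : R) : 0 < w ->
  exists B, 0 < B /\ forall s u v, 0 <= s <= 1 -> hill w s u v ->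
    u 0 = x -> v 0 = y -> forall t, 0 <= t <= PI -> Rabs (u t) <= B.
Proof.
intros w0.
set (A := (y ^ 2 + w ^ 2 * x ^ 2) * exp (1 / w * PI) / w ^ 2).
assert (A0 : 0 <= A).
{ unfold A; apply Rdiv_le_0_compat; [|nra].
  apply Rmult_le_pos; [|left; apply exp_pos].
  assert (H1 := pow2_ge_0 y); assert (H2 := pow2_ge_0 (w * x)); nra. }
(* [A] bounds the square of [u], and [A <= (1 + A) ^ 2]. *)
exists (1 + A); split; [lra|].
intros s u v Hs H Hu Hv t Ht.
assert (G := amp_growth w s u v 0 t w0 (proj1 Hs) H).
rewrite Rabs_right in G by lra.
assert (E : exp (s / w * (t - 0)) <= exp (1 / w * PI)).
{ apply exp_le, Rmult_le_compat; try lra.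
  - apply Rdiv_le_0_compat; lra.
  - apply Rmult_le_compat_r; [|lra]; left; now apply Rinv_0_lt_compat. }
assert (U : u t ^ 2 <= A).
{ unfold A; apply -> Rle_div_r; [|now apply pow_lt].
  unfold amp in G; rewrite Hu, Hv in G.
  assert (H1 := pow2_ge_0 (v t)).
  assert (H2 := amp_ge_0 w u v 0); unfold amp in H2; rewrite Hu, Hv in H2.
  assert (H3 := Rmult_le_compat_l _ _ _ H2 E); lra. }
rewrite <- (Rabs_pos_eq (1 + A)) by lra.
apply Rsqr_le_abs_0; rewrite !Rsqr_pow2.
eapply Rle_trans; [apply U | nra].
Qed.

(** Variation of constants: [W r] carries the state at time [r] to time [t] by the free flow. It
    joins the free value at [r = 0] to the true one at [r = t], and only the perturbation
    contributes to its derivative. *)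
Lemma hill_near_free (w s B : R) (u v : R -> R) : 0 < w -> 0 <= s ->
  hill w s u v -> (forall t, 0 <= t <= PI -> Rabs (u t) <= B) ->
  forall t, 0 <= t <= PI ->
    Rabs (w * u t - free w (u 0) (v 0) t) <= s * B * PI /\
    Rabs (v t - (v 0 * cos (w * t) - w * u 0 * sin (w * t))) <= s * B * PI.
Proof.
intros w0 s0 H HB t Ht.
assert (B0 : 0 <= B) by (eapply Rle_trans; [apply Rabs_pos | apply (HB t Ht)]).
assert (sB : 0 <= s * B) by (apply Rmult_le_pos; lra).
assert (K : forall g : R -> R, (forall r, Rabs (g r) <= 1) ->
  forall r, 0 <= r <= t -> Rabs (- (s * cos r ^ 2 * u r * g r)) <= s * B).
{ intros g Hg r Hr.
  rewrite Rabs_Ropp, !Rabs_mult, (Rabs_pos_eq s) by lra.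
  assert (C := cos_sq_bound r); rewrite (Rabs_pos_eq (cos r ^ 2)) by lra.
  assert (U := HB r ltac:(lra)); assert (G := Hg r).
  assert (U0 := Rabs_pos (u r)); assert (G0 := Rabs_pos (g r)).
  replace (s * B) with (s * 1 * B * 1) by ring.
  repeat apply Rmult_le_compat; try lra.
  - apply Rmult_le_pos; [apply Rmult_le_pos; lra | lra].
  - apply Rmult_le_pos; lra. }
split.
- set (W := fun r => v r * sin (w * (t - r)) + w * u r * cos (w * (t - r))).
  assert (D := increment_abs_le W
    (fun r => - (s * cos r ^ 2 * u r * sin (w * (t - r)))) 0 t (s * B)
    (proj1 Ht)).
  replace (w * u t - free w (u 0) (v 0) t) with (W t - W 0).
  + eapply Rle_trans; [apply D|].
    * intros r; destruct (H r) as [U V]; unfold W; auto_derive.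
      -- repeat split; eexists; eassumption.
      -- rewrite (is_derive_unique (fun x : R => u x) r _ U),
          (is_derive_unique (fun x : R => v x) r _ V); unfold Rminus; ring.
    * apply K; intros r; apply Rabs_le, SIN_bound.
    * apply Rmult_le_compat_l; lra.
  + unfold W, free; rewrite !Rminus_0_r.
    replace (w * (t - t)) with 0 by ring; rewrite sin_0, cos_0; ring.
- set (W := fun r => v r * cos (w * (t - r)) - w * u r * sin (w * (t - r))).
  assert (D := increment_abs_le W
    (fun r => - (s * cos r ^ 2 * u r * cos (w * (t - r)))) 0 t (s * B)
    (proj1 Ht)).
  replace (v t - _) with (W t - W 0).
  + eapply Rle_trans; [apply D|].
    * intros r; destruct (H r) as [U V]; unfold W; auto_derive.
      -- repeat split; eexists; eassumption.
      -- rewrite (is_derive_unique (fun x : R => u x) r _ U),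
          (is_derive_unique (fun x : R => v x) r _ V); unfold Rminus; ring.
    * apply K; intros r; apply Rabs_le, COS_bound.
    * apply Rmult_le_compat_l; lra.
  + unfold W; rewrite !Rminus_0_r.
    replace (w * (t - t)) with 0 by ring; rewrite sin_0, cos_0; ring.
Qed.

(** * Signs of the solutions at the end of a period *)

(** Meant for the integrand [cos^2 t free(t)^2], which is positive near 0 but vanishes at
    [PI / 2]. *)
Lemma RInt_pos_of_pos_near_left (f : R -> R) (a h b : R) : a < h <= b ->
  (forall t, continuous f t) -> (forall t, 0 <= f t) ->
  (forall t, a < t < h -> 0 < f t) -> 0 < RInt f a b.
Proof.
intros Hab Hc H0 Hp.
rewrite <- (RInt_Chasles f a h b);
  try (apply (ex_RInt_continuous f); intros; apply Hc).
assert (P1 : 0 < RInt f a h) by (apply RInt_gt_0; [lra | assumption | intros; apply Hc]).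
assert (P2 : 0 <= RInt f h b)
  by (apply RInt_ge_0; [lra | apply (ex_RInt_continuous f); intros; apply Hc
     | intros; apply H0]).
change (0 < RInt f a h + RInt f h b); lra.
Qed.

(* The Wronskian of the solution with its unperturbed approximation [free]
   has derivative [- s cos^2 t u(t) free(t)], nearly
   [- s cos^2 t free(t)^2 / w]. *)
Lemma hill_wronskian_neg (w x y h : R) : 0 < w -> 0 < h <= PI ->
  (forall t, 0 < t < h -> 0 < cos t ^ 2 * free w x y t ^ 2) ->
  exists s0, 0 < s0 /\ forall s u v, 0 < s <= s0 -> hill w s u v ->
    u 0 = x -> v 0 = y ->
    v PI * free w x y PI
      - u PI * (w * (y * cos (w * PI) - w * x * sin (w * PI))) < 0.
Proof.
intros w0 Hh Hpos.
set (f := fun t => cos t ^ 2 * free w x y t ^ 2).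
assert (fc : forall t, continuous f t).
{ intros t; apply (ex_derive_continuous f); unfold f, free.
  auto_derive; exact I. }
assert (IP : 0 < RInt f 0 PI).
{ apply RInt_pos_of_pos_near_left with h; trivial.
  intros t; unfold f; apply Rmult_le_pos; apply pow2_ge_0. }
set (I1 := RInt f 0 PI) in *.
destruct (hill_bounded w x y w0) as [B [B0 HB]].
set (L := 1 + Rabs y + Rabs (w * x)).
assert (L1 : 1 <= L)
  by (assert (P1 := Rabs_pos y); assert (P2 := Rabs_pos (w * x)); unfold L; lra).
assert (P0 := PI_RGT_0).
(* The total error will be [s / w * (s * Q)]: [s * B * PI] bounds the distance to [free], [L] bounds
   [free], and the last [PI] is the length of the interval. *)
set (Q := B * PI * L * PI).
assert (Q0 : 0 < Q) by (unfold Q; do 3 (apply Rmult_lt_0_compat; [|lra]); exact B0).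
(* The cap 1 is the range of the uniform bound [B]; the factor 2 makes [s * Q < I1] strict. *)
exists (Rmin 1 (I1 / (2 * Q))); split.
{ apply Rmin_glb_lt; [lra|]; apply Rdiv_lt_0_compat; lra. }
intros s u v [s0 Hs] H Hu Hv.
assert (s1 : s <= 1) by (eapply Rle_trans; [apply Hs | apply Rmin_l]).
assert (s2 : s * Q < I1).
{ assert (s2 : s <= I1 / (2 * Q)) by (eapply Rle_trans; [apply Hs | apply Rmin_r]).
  apply <- Rle_div_r in s2; [|lra].
  assert (0 < s * Q) by (apply Rmult_lt_0_compat; lra); lra. }
assert (HU := HB s u v ltac:(lra) H Hu Hv).
assert (NF := hill_near_free w s B u v w0 ltac:(lra) H HU).
rewrite Hu, Hv in NF.
set (g := free w x y) in *.
(* [dg] is the derivative of [g], so [F] below is the Wronskian. *)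
set (dg := fun t => w * (y * cos (w * t) - w * x * sin (w * t))).
set (F := fun t => v t * g t - u t * dg t).
(* Adding the integral cancels the leading part of the derivative of [F]; what remains is of order
   [s ^ 2]. *)
assert (D : (F PI + s / w * RInt f 0 PI) - (F 0 + s / w * RInt f 0 0)
   <= s / w * (s * B * PI * L) * (PI - 0)).
{ apply (increment_le (fun t => F t + s / w * RInt f 0 t)
    (fun t => - (s * cos t ^ 2 * u t * g t) + s / w * f t)).
  - lra.
  - intros t; destruct (H t) as [U V].
    apply (is_derive_plus F (fun t => s / w * RInt f 0 t)).
    + unfold F, g, dg, free; auto_derive.
      * repeat split; eexists; eassumption.
      * rewrite (is_derive_unique (fun x : R => u x) t _ U),
          (is_derive_unique (fun x : R => v x) t _ V); ring.
    + apply is_derive_scal, (is_derive_RInt f _ 0).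
      * exists posreal_one; intros z _; apply (@RInt_correct R_CompleteNormedModule).
        apply (ex_RInt_continuous f); intros; apply fc.
      * apply fc.
  - intros t Ht; destruct (NF t Ht) as [N _].
    replace (- (s * cos t ^ 2 * u t * g t) + s / w * f t) with
      (s / w * (cos t ^ 2 * (- (w * u t - g t) * g t)))
      by (unfold f; fold g; field; lra).
    apply Rmult_le_compat_l; [left; apply Rdiv_lt_0_compat; lra|].
    assert (C := cos_sq_bound t).
    assert (GB : Rabs (g t) <= L)
      by (eapply Rle_trans; [apply free_bound | unfold L; lra]).
    eapply Rle_trans; [apply Rle_abs|].
    rewrite !Rabs_mult, Rabs_Ropp, (Rabs_pos_eq (cos t ^ 2)) by lra.
    assert (A1 := Rabs_pos (w * u t - g t)); assert (A2 := Rabs_pos (g t)).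
    rewrite <- (Rmult_1_l (s * B * PI * L)).
    apply Rmult_le_compat; try lra.
    + apply Rmult_le_pos; lra.
    + apply Rmult_le_compat; lra. }
rewrite RInt_point in D; fold I1 in D.
assert (F0 : F 0 = 0).
{ unfold F, g, dg, free; rewrite Hu, Hv, !Rmult_0_r, sin_0, cos_0; ring. }
rewrite F0 in D; change (zero : R) with 0 in D.
change (F PI < 0).
assert (sw : 0 < s / w) by (apply Rdiv_lt_0_compat; lra).
assert (E : 0 < s / w * (I1 - s * Q)) by (apply Rmult_lt_0_compat; lra).
unfold Q in E; nra.
Qed.

(** Serves the non-resonant case, where the unperturbed end values are nonzero and closeness alone
    fixes the signs. *)
Lemma hill_end_near_free (w x y e : R) : 0 < w -> 0 < e ->
  exists s0, 0 < s0 /\ forall s u v, 0 < s <= s0 -> hill w s u v ->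
    u 0 = x -> v 0 = y ->
    Rabs (w * u PI - free w x y PI) < e /\
    Rabs (v PI - (y * cos (w * PI) - w * x * sin (w * PI))) < e.
Proof.
intros w0 e0.
destruct (hill_bounded w x y w0) as [B [B0 HB]].
assert (P0 := PI_RGT_0).
assert (BP : 0 < B * PI) by (apply Rmult_lt_0_compat; lra).
exists (Rmin 1 (e / (2 * (B * PI)))); split.
{ apply Rmin_glb_lt; [lra|]; apply Rdiv_lt_0_compat; lra. }
intros s u v [s0 Hs] H Hu Hv.
assert (s1 : s <= 1) by (eapply Rle_trans; [apply Hs | apply Rmin_l]).
assert (s2 : s * B * PI < e).
{ assert (s2 : s <= e / (2 * (B * PI)))
    by (eapply Rle_trans; [apply Hs | apply Rmin_r]).
  apply <- Rle_div_r in s2; [|lra].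
  assert (0 < s * (B * PI)) by (apply Rmult_lt_0_compat; lra); lra. }
destruct (hill_near_free w s B u v w0 ltac:(lra) H
  (HB s u v ltac:(lra) H Hu Hv) PI ltac:(lra)) as [N1 N2].
rewrite Hu, Hv in N1, N2; split; lra.
Qed.

(** The condition c'(PI) d(PI) < 0, with [sg] any number having the sign of d(PI). Quantifying over
    all solutions avoids presupposing that c and d exist. *)
Definition end_signs (w s sg : R) : Prop := forall u v, hill w s u v ->
  (u 0 = 0 -> v 0 = 1 -> 0 < sg * u PI) /\
  (u 0 = 1 -> v 0 = 0 -> sg * v PI < 0).

Lemma hill_end_signs (w : R) : 0 < w ->
  exists sg s0, 0 < s0 /\ forall s, 0 < s <= s0 -> end_signs w s sg.
Proof.
intros w0; assert (P0 := PI_RGT_0).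
destruct (Req_dec (sin (w * PI)) 0) as [res|res].
(* Resonant case. With [h + w * h = PI / 2], both [t] and [w * t] stay in the open first quadrant
   for [0 < t < h]. *)
- set (h := PI / (2 * (1 + w))).
  assert (h0 : 0 < h) by (apply Rdiv_lt_0_compat; lra).
  assert (hE : h + w * h = PI / 2) by (unfold h; field; lra).
  assert (wh : 0 < w * h) by (apply Rmult_lt_0_compat; lra).
  assert (Hh : 0 < h <= PI) by lra.
  assert (T : forall t, 0 < t < h ->
    0 < cos t /\ 0 < sin (w * t) /\ 0 < cos (w * t)).
  { intros t Ht.
    assert (0 < w * t < w * h)
      by (split; [apply Rmult_lt_0_compat | apply Rmult_lt_compat_l]; lra).
    split; [|split]; [apply cos_gt_0 | apply sin_gt_0 | apply cos_gt_0]; lra. }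
  destruct (hill_wronskian_neg w 0 1 h w0 Hh) as [s1 [s1p H1]].
  { intros t Ht; destruct (T t Ht) as [T1 [T2 T3]]; unfold free.
    replace (1 * sin (w * t) + w * 0 * cos (w * t)) with (sin (w * t)) by ring.
    apply Rmult_lt_0_compat; apply pow_lt; assumption. }
  destruct (hill_wronskian_neg w 1 0 h w0 Hh) as [s2 [s2p H2]].
  { intros t Ht; destruct (T t Ht) as [T1 [T2 T3]]; unfold free.
    replace (0 * sin (w * t) + w * 1 * cos (w * t)) with (w * cos (w * t)) by ring.
    apply Rmult_lt_0_compat; apply pow_lt; [assumption|].
    now apply Rmult_lt_0_compat. }
  (* Since [sin (w * PI) = 0], the Wronskian at [PI] reduces to [- w cos (w * PI) d(PI)] for the odd
     solution and [w cos (w * PI) c'(PI)] for the even one. *)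
  exists (cos (w * PI)), (Rmin s1 s2); split; [now apply Rmin_glb_lt|].
  intros s [s0 Hs] u v H; split; intros Hu Hv.
  + specialize (H1 s u v (conj s0 (Rle_trans _ _ _ Hs (Rmin_l _ _))) H Hu Hv).
    unfold free in H1; rewrite res in H1.
    apply Rmult_lt_reg_l with w; [assumption|]; lra.
  + specialize (H2 s u v (conj s0 (Rle_trans _ _ _ Hs (Rmin_r _ _))) H Hu Hv).
    unfold free in H2; rewrite res in H2.
    apply Rmult_lt_reg_l with w; [assumption|]; lra.
(* Non-resonant case: [w d(PI)] is close to [sg] and [c'(PI)] to [- w * sg], hence the two
   tolerances. *)
- set (sg := sin (w * PI)) in *.
  assert (sg0 : 0 < Rabs sg) by now apply Rabs_pos_lt.
  destruct (hill_end_near_free w 0 1 (Rabs sg) w0 sg0) as [s1 [s1p H1]].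
  destruct (hill_end_near_free w 1 0 (w * Rabs sg) w0) as [s2 [s2p H2]].
  { now apply Rmult_lt_0_compat. }
  exists sg, (Rmin s1 s2); split; [now apply Rmin_glb_lt|].
  assert (near : forall r, Rabs (r - sg) < Rabs sg -> 0 < sg * r).
  { intros r Hr; apply Rsqr_lt_abs_1 in Hr; unfold Rsqr in Hr.
    assert (0 <= r * r) by apply Rle_0_sqr; nra. }
  intros s [s0 Hs] u v H; split; intros Hu Hv.
  + destruct (H1 s u v (conj s0 (Rle_trans _ _ _ Hs (Rmin_l _ _))) H Hu Hv)
      as [N _].
    unfold free in N; fold sg in N.
    apply Rmult_lt_reg_l with w; [assumption|].
    replace (w * (sg * u PI)) with (sg * (w * u PI)) by ring.
    rewrite Rmult_0_r; apply near.
    now replace (w * u PI - sg) with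
      (w * u PI - (1 * sg + w * 0 * cos (w * PI))) by ring.
  + destruct (H2 s u v (conj s0 (Rle_trans _ _ _ Hs (Rmin_r _ _))) H Hu Hv)
      as [_ N].
    fold sg in N.
    assert (0 < sg * (- v PI / w)).
    { apply near; apply Rmult_lt_reg_l with w; [assumption|].
      rewrite <- (Rabs_pos_eq w) at 1 by lra.
      rewrite <- Rabs_mult, <- Rabs_Ropp.
      now replace (- (w * (- v PI / w - sg))) with
        (v PI - (0 * cos (w * PI) - w * 1 * sg)) by (field; lra). }
    assert (E : w * (sg * (- v PI / w)) = - (sg * v PI)) by (field; lra).
    assert (0 < w * (sg * (- v PI / w))) by now apply Rmult_lt_0_compat.
    lra.
Qed.

(** * Fundamental system and invariant quadratic form *)

(** Take [(u(t) + u(- t)) / (2 u(0))]; the odd counterpart below subtracts the reflection and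
    divides by [2 v(0)]. *)
Lemma hill_even_part (w s : R) (u v : R -> R) : hill w s u v -> u 0 <> 0 ->
  exists c dc, hill w s c dc /\ c 0 = 1 /\ dc 0 = 0.
Proof.
intros H Hu.
eexists _, _; split; [|split].
- exact (hill_lincomb w s (/ (2 * u 0)) (/ (2 * u 0)) _ _ _ _ H
    (hill_reflect w s u v H)).
- cbv beta; rewrite Ropp_0; field; assumption.
- cbv beta; rewrite Ropp_0; ring.
Qed.

Lemma hill_odd_part (w s : R) (u v : R -> R) : hill w s u v -> v 0 <> 0 ->
  exists c dc, hill w s c dc /\ c 0 = 0 /\ dc 0 = 1.
Proof.
intros H Hv.
eexists _, _; split; [|split].
- exact (hill_lincomb w s (/ (2 * v 0)) (- / (2 * v 0)) _ _ _ _ H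
    (hill_reflect w s u v H)).
- cbv beta; rewrite Ropp_0; ring.
- cbv beta; rewrite Ropp_0; field; assumption.
Qed.

(* This replaces the existence theorem for linear equations: one nonzero
   solution yields a fundamental system by reflecting and translating it. *)
Lemma hill_fundamental (w s sg : R) (u v : R -> R) : end_signs w s sg ->
  hill w s u v -> u 0 <> 0 \/ v 0 <> 0 ->
  exists c dc d dd, hill w s c dc /\ hill w s d dd /\
    c 0 = 1 /\ dc 0 = 0 /\ d 0 = 0 /\ dd 0 = 1.
Proof.
intros HS H [Hu|Hv].
- destruct (hill_even_part w s u v H Hu) as [c [dc [Hc [c0 dc0]]]].
  assert (N := proj2 (HS c dc Hc) c0 dc0).
  (* The translate of [c] by [PI] has derivative [dc PI] at 0, nonzero by [N], so its odd part can
     be normalized. The other case is symmetric, with [d PI]. *)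
  destruct (hill_odd_part w s _ _ (hill_shift w s PI c dc sin_PI Hc))
    as [d [dd [Hd [d0 dd0]]]].
  { rewrite Rplus_0_l; intros E; rewrite E in N; lra. }
  exists c, dc, d, dd; tauto.
- destruct (hill_odd_part w s u v H Hv) as [d [dd [Hd [d0 dd0]]]].
  assert (N := proj1 (HS d dd Hd) d0 dd0).
  destruct (hill_even_part w s _ _ (hill_shift w s PI d dd sin_PI Hd))
    as [c [dc [Hc [c0 dc0]]]].
  { rewrite Rplus_0_l; intros E; rewrite E in N; lra. }
  exists c, dc, d, dd; tauto.
Qed.

Lemma sin_INR_PI (k : nat) : sin (INR k * PI) = 0.
Proof. apply sin_eq_0_1; exists (Z.of_nat k); now rewrite INR_IZR_INZ. Qed.

(* The half-period map is [[a, b], [c, a]] with [a^2 - b c = 1] because the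
   coefficient is even; it preserves the form [- c x^2 + b y^2], definite by
   the sign conditions. *)
Lemma hill_period_form (w s sg : R) : 0 < w -> 0 <= s -> end_signs w s sg ->
  exists p q, 0 < p /\ 0 < q /\ forall u v, hill w s u v ->
    forall k : nat, p * u (INR k * PI) ^ 2 + q * v (INR k * PI) ^ 2
      = p * u 0 ^ 2 + q * v 0 ^ 2.
Proof.
intros w0 s0 HS.
(* Either a nonzero solution generates a fundamental system, or every solution has zero data and any
   positive form is preserved. *)
destruct (classic (exists u v, hill w s u v /\ (u 0 <> 0 \/ v 0 <> 0)))
  as [[u1 [v1 [H1 N1]]]|none].
- destruct (hill_fundamental w s sg u1 v1 HS H1 N1)
    as [c [dc [d [dd [Hc [Hd [c0 [dc0 [d0 dd0]]]]]]]]].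
  assert (SC := proj2 (HS c dc Hc) c0 dc0).
  assert (SD := proj1 (HS d dd Hd) d0 dd0).
  assert (span : forall u v, hill w s u v -> forall t,
    u t = u 0 * c t + v 0 * d t /\ v t = u 0 * dc t + v 0 * dd t).
  { intros u v H.
    apply (hill_unique w s _ _ _ _ w0 s0 H
      (hill_lincomb w s (u 0) (v 0) _ _ _ _ Hc Hd));
      rewrite ?c0, ?dc0, ?d0, ?dd0; ring. }
  assert (even := hill_unique w s _ _ _ _ w0 s0 Hc (hill_reflect w s _ _ Hc)).
  cbv beta in even; rewrite Ropp_0, dc0 in even.
  destruct (even eq_refl ltac:(ring) (- PI)) as [e1 e2].
  rewrite Ropp_involutive in e1, e2.
  assert (sp : sin (- PI) = 0) by (rewrite sin_neg, sin_PI; ring).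
  (* Expanding [c(t - PI)] at [t = PI] in the basis, with [c] even, gives the determinant identity
     ([r1]) and, after cancelling [dc PI], the equality of the diagonal entries ([r2]). *)
  destruct (span _ _ (hill_shift w s (- PI) c dc sp Hc) PI) as [r1 r2].
  cbv beta in r1, r2.
  rewrite Rplus_opp_r, Rplus_0_l, e1, e2 in r1, r2.
  rewrite c0 in r1; rewrite dc0 in r2.
  assert (dd1 : dd PI = c PI).
  { apply Rmult_eq_reg_l with (dc PI); [lra|].
    intros E; rewrite E in SC; lra. }
  exists (- (sg * dc PI)), (sg * d PI); split; [lra|]; split; [lra|].
  assert (step : forall u v, hill w s u v ->
    - (sg * dc PI) * u PI ^ 2 + sg * d PI * v PI ^ 2
     = - (sg * dc PI) * u 0 ^ 2 + sg * d PI * v 0 ^ 2).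
  { intros u v H; destruct (span u v H PI) as [-> ->]; rewrite dd1.
    (* The inserted factor 1 is then rewritten as the determinant. *)
    replace (- (sg * dc PI) * u 0 ^ 2 + sg * d PI * v 0 ^ 2) with
      ((- (sg * dc PI) * u 0 ^ 2 + sg * d PI * v 0 ^ 2) * 1) by ring.
    rewrite r1; ring. }
  intros u v H; induction k as [|k IH].
  + now rewrite Rmult_0_l.
  + rewrite <- IH.
    assert (E := step _ _ (hill_shift w s _ u v (sin_INR_PI k) H)).
    cbv beta in E; rewrite Rplus_0_l in E.
    rewrite S_INR; now replace ((INR k + 1) * PI) with (PI + INR k * PI) by ring.
- exists 1, 1; split; [lra|]; split; [lra|].
  intros u v H k.
  assert (Z : u 0 = 0 /\ v 0 = 0).
  { split; apply NNPP; intros E; apply none; exists u, v; tauto. }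
  destruct Z as [Zu Zv].
  destruct (hill_null w s u v w0 s0 H Zu Zv (INR k * PI)) as [-> ->].
  now rewrite Zu, Zv.
Qed.

(** * Boundedness for all later times *)

Lemma floor_period (t : R) : 0 <= t ->
  exists k : nat, INR k * PI <= t <= INR k * PI + PI.
Proof.
intros Ht; assert (P0 := PI_RGT_0).
destruct (nfloor_ex (t / PI)) as [k [K1 K2]].
{ apply Rdiv_le_0_compat; lra. }
exists k; split.
- apply <- Rle_div_r; lra.
- replace (INR k * PI + PI) with ((INR k + 1) * PI) by ring.
  apply -> Rle_div_l; lra.
Qed.

(** At multiples of [PI] the invariant form controls [amp]; from the last multiple to [t], the
    growth estimate costs at most the factor [G]. *)
Lemma hill_forward_bounded (w s sg : R) : 0 < w -> 0 <= s -> end_signs w s sg ->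
  exists K, 0 < K /\ forall u v, hill w s u v -> forall t, 0 <= t ->
    amp w u v t <= K * amp w u v 0.
Proof.
intros w0 s0 HS; assert (P0 := PI_RGT_0).
destruct (hill_period_form w s sg w0 s0 HS) as [p [q [p0 [q0 HF]]]].
assert (w2 : 0 < w ^ 2) by now apply pow_lt.
set (G := exp (s / w * PI)).
assert (G0 : 0 < G) by apply exp_pos.
(* The first factor bounds [amp] by the form, the second bounds the form by [amp]. *)
set (M := (w ^ 2 / p + 1 / q) * (p / w ^ 2 + q)).
assert (M1 : 0 < w ^ 2 / p + 1 / q)
  by (apply Rplus_lt_0_compat; apply Rdiv_lt_0_compat; lra).
assert (M2 : 0 < p / w ^ 2 + q)
  by (apply Rplus_lt_0_compat; [apply Rdiv_lt_0_compat|]; lra).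
assert (M0 : 0 < M) by now apply Rmult_lt_0_compat.
exists (M * G); split; [now apply Rmult_lt_0_compat|].
intros u v H t Ht.
destruct (floor_period t Ht) as [k Hk].
assert (A := amp_growth_right w s u v (INR k * PI) t w0 s0 H (proj1 Hk)).
assert (E : exp (s / w * (t - INR k * PI)) <= G).
{ apply exp_le, Rmult_le_compat_l; [|lra].
  apply Rdiv_le_0_compat; lra. }
assert (B : amp w u v (INR k * PI) <= M * amp w u v 0).
{ assert (F := HF u v H k); unfold amp, M.
  set (x := u (INR k * PI)) in *; set (y := v (INR k * PI)) in *.
  assert (X0 := pow2_ge_0 (u 0)); assert (Y0 := pow2_ge_0 (v 0)).
  assert (X := pow2_ge_0 x); assert (Y := pow2_ge_0 y).
  assert (B1 : y ^ 2 + w ^ 2 * x ^ 2 <=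
    (w ^ 2 / p + 1 / q) * (p * x ^ 2 + q * y ^ 2)).
  { replace ((w ^ 2 / p + 1 / q) * (p * x ^ 2 + q * y ^ 2)) with
      (y ^ 2 + w ^ 2 * x ^ 2 + (w ^ 2 * q / p * y ^ 2 + p / q * x ^ 2))
      by (field; lra).
    assert (0 <= w ^ 2 * q / p * y ^ 2 + p / q * x ^ 2); [|lra].
    apply Rplus_le_le_0_compat; apply Rmult_le_pos; trivial;
      apply Rdiv_le_0_compat; nra. }
  assert (B2 : p * u 0 ^ 2 + q * v 0 ^ 2 <=
    (p / w ^ 2 + q) * (v 0 ^ 2 + w ^ 2 * u 0 ^ 2)).
  { replace ((p / w ^ 2 + q) * (v 0 ^ 2 + w ^ 2 * u 0 ^ 2)) with
      (p * u 0 ^ 2 + q * v 0 ^ 2 + (p / w ^ 2 * v 0 ^ 2 + q * w ^ 2 * u 0 ^ 2))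
      by (field; lra).
    assert (0 <= p / w ^ 2 * v 0 ^ 2 + q * w ^ 2 * u 0 ^ 2); [|lra].
    apply Rplus_le_le_0_compat; apply Rmult_le_pos; trivial.
    - apply Rdiv_le_0_compat; lra.
    - apply Rmult_le_pos; lra. }
  rewrite F in B1.
  eapply Rle_trans; [apply B1|].
  rewrite Rmult_assoc; apply Rmult_le_compat_l; lra. }
eapply Rle_trans; [apply A|].
replace (M * G * amp w u v 0) with (M * amp w u v 0 * G) by ring.
apply Rmult_le_compat; trivial; [apply amp_ge_0 | left; apply exp_pos].
Qed.

(** Passing from [t0] to time 0, or to a time between them, costs at most [G]; [K + 1] serves both
    signs of [t]. *)
Lemma hill_bounded_from (w s sg t0 : R) :
  0 < w -> 0 <= s -> end_signs w s sg ->
  exists K, 0 < K /\ forall u v, hill w s u v -> forall t, t0 <= t ->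
    amp w u v t <= K * amp w u v t0.
Proof.
intros w0 s0 HS.
destruct (hill_forward_bounded w s sg w0 s0 HS) as [K [K0 HK]].
set (G := exp (s / w * Rabs t0)).
assert (G0 : 0 < G) by apply exp_pos.
exists ((K + 1) * G); split; [apply Rmult_lt_0_compat; lra|].
assert (sw : 0 <= s / w) by (apply Rdiv_le_0_compat; lra).
intros u v H.
assert (loc : forall t, Rabs (t - t0) <= Rabs t0 ->
  amp w u v t <= G * amp w u v t0).
{ intros t Ht; eapply Rle_trans; [apply (amp_growth w s u v t0 t w0 s0 H)|].
  rewrite Rmult_comm; apply Rmult_le_compat_r; [apply amp_ge_0|].
  apply exp_le, Rmult_le_compat_l; assumption. }
assert (A := amp_ge_0 w u v t0).
assert (GA : 0 <= G * amp w u v t0) by (apply Rmult_le_pos; lra).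
intros t Ht; destruct (Rle_dec 0 t) as [t1|t1].
- eapply Rle_trans; [apply (HK u v H t t1)|].
  apply Rle_trans with (K * (G * amp w u v t0)).
  + apply Rmult_le_compat_l; [lra|]; apply loc.
    rewrite Rminus_0_l, Rabs_Ropp; lra.
  + nra.
- apply Rle_trans with (G * amp w u v t0); [|nra].
  apply loc; rewrite Rabs_right, Rabs_left; lra.
Qed.

(** * Lyapunov stability and the energy threshold *)

(** As [cos^2 t = (1 + cos 2t) / 2], the two equations coincide, and the linear bound on [amp] gives
    stability. *)
Lemma mathieu_stable_of_signs (w s sg alpha q : R) :
  0 < w -> 0 <= s -> end_signs w s sg ->
  alpha = w ^ 2 + s / 2 -> q = s / 4 -> mathieu_trivial_stable alpha q.
Proof.
intros w0 s0 HS -> -> t0 eps e0.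
destruct (hill_bounded_from w s sg t0 w0 s0 HS) as [K [K0 HK]].
assert (w2 : 0 < w ^ 2) by now apply pow_lt.
(* [amp < m ^ 2 * eps ^ 2] bounds both the solution and its derivative by [eps]. *)
set (m := Rmin 1 w).
assert (m0 : 0 < m) by (apply Rmin_glb_lt; lra).
assert (m1 : m <= 1) by apply Rmin_l.
assert (mw : m <= w) by apply Rmin_r.
set (T := K * (1 + w ^ 2)).
assert (T0 : 0 < T) by (apply Rmult_lt_0_compat; lra).
assert (rT : 0 < sqrt T) by now apply sqrt_lt_R0.
(* Data below [delta] have [amp] below [(1 + w ^ 2) * delta ^ 2]; [delta] solves
   [T * delta ^ 2 = m ^ 2 * eps ^ 2]. *)
exists (m * eps / sqrt T); split.
{ apply Rdiv_lt_0_compat; [now apply Rmult_lt_0_compat | assumption]. }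
set (delta := m * eps / sqrt T).
assert (Td : T * delta ^ 2 = m ^ 2 * eps ^ 2).
{ unfold delta; rewrite <- (pow2_sqrt T) at 1 by lra; field; lra. }
intros xi Hxi Hx Hy t Ht.
assert (H : hill w s xi (Derive xi)).
{ intros r; destruct (Hxi r) as [D1 D2]; split; [now apply Derive_correct|].
  replace (w ^ 2 + s * cos r ^ 2) with
    (w ^ 2 + s / 2 + 2 * (s / 4) * cos (2 * r)); [assumption|].
  rewrite cos_2a_cos; field. }
assert (A := HK _ _ H t Ht); unfold amp in A.
assert (sq : forall x d, Rabs x < d -> x ^ 2 < d ^ 2).
{ intros x d Hd; rewrite <- (pow2_abs x).
  assert (P := Rabs_pos x); nra. }
assert (X := sq _ _ Hx); assert (Y := sq _ _ Hy).
assert (L : Derive xi t ^ 2 + w ^ 2 * xi t ^ 2 < m ^ 2 * eps ^ 2).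
{ eapply Rle_lt_trans; [apply A|].
  fold delta in X, Y; rewrite <- Td; unfold T.
  rewrite Rmult_assoc; apply Rmult_lt_compat_l; nra. }
assert (P1 := pow2_ge_0 (Derive xi t)); assert (P2 := pow2_ge_0 (xi t)).
assert (e2 : 0 < eps ^ 2) by now apply pow_lt.
rewrite <- (Rabs_pos_eq eps) by lra.
assert (mm : m ^ 2 <= 1) by nra.
assert (mm' : m ^ 2 <= w ^ 2) by nra.
split; apply Rsqr_lt_abs_0; unfold Rsqr.
- assert (w ^ 2 * xi t ^ 2 < w ^ 2 * eps ^ 2) by nra.
  apply Rmult_lt_reg_l with (w ^ 2); [assumption|]; lra.
- nra.
Qed.

Theorem corollary2p4 :
  forall mu lambda1 lambda2 : R, 0 < mu -> 0 < lambda1 -> 0 < lambda2 ->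
  exists Ebar : R, 0 < Ebar /\
    forall x0 : R, x0 <> 0 ->
      mu ^ 2 / 2 * x0 ^ 2 <= Ebar ->
      ybar_stable mu lambda1 lambda2 x0.
Proof.
intros mu l1 l2 mu0 l10 l20.
assert (w10 : 0 < l1 / mu) by now apply Rdiv_lt_0_compat.
assert (w20 : 0 < l2 / mu) by now apply Rdiv_lt_0_compat.
destruct (hill_end_signs _ w10) as [sg1 [s1 [s10 H1]]].
destruct (hill_end_signs _ w20) as [sg2 [s2 [s20 H2]]].
assert (mu4 : 0 < mu ^ 4) by now apply pow_lt.
assert (mn : 0 < Rmin s1 s2) by now apply Rmin_glb_lt.
(* With [s = x0 ^ 2 / mu ^ 2] the energy is [mu ^ 4 / 2 * s], so the bound says that [s] is below
   both thresholds. *)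
exists (mu ^ 4 / 2 * Rmin s1 s2); split.
{ apply Rmult_lt_0_compat; lra. }
intros x0 x0n HE.
assert (sp : 0 < x0 ^ 2 / mu ^ 2).
{ apply Rdiv_lt_0_compat; [|now apply pow_lt].
  rewrite <- Rsqr_pow2; now apply Rsqr_pos_lt. }
assert (sm : x0 ^ 2 / mu ^ 2 <= Rmin s1 s2).
{ apply Rmult_le_reg_l with (mu ^ 4 / 2); [lra|].
  replace (mu ^ 4 / 2 * (x0 ^ 2 / mu ^ 2)) with (mu ^ 2 / 2 * x0 ^ 2)
    by (field; lra).
  exact HE. }
assert (sm1 := Rle_trans _ _ _ sm (Rmin_l _ _)).
assert (sm2 := Rle_trans _ _ _ sm (Rmin_r _ _)).
split.
- apply (mathieu_stable_of_signs (l1 / mu) (x0 ^ 2 / mu ^ 2) sg1); try lra.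
  + now apply H1.
  + unfold mathieu_alpha; field; lra.
  + unfold mathieu_q; field; lra.
- apply (mathieu_stable_of_signs (l2 / mu) (x0 ^ 2 / mu ^ 2) sg2); try lra.
  + now apply H2.
  + unfold mathieu_alpha; field; lra.
  + unfold mathieu_q; field; lra.
Qed.
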